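(* Let $\tau$ be a finite nonempty set of proposition symbols and let $d\in\mathbb Z_+$. There is $n_0$ (depending only on $d$ and the fixed vocabulary $\tau$) such that for every $n\ge n_0$ the following hold for the relations $\preceq_\tau,\le_s,\le_c$ on the set of all $(n,d)$-admissible tuples: \[\preceq_\tau\ \subseteq\ \le_s\cap\le_c .\] In particular, if $\overline n$ and $\overline n'$ are two distinct $\preceq_\tau$-comparable $(n,d)$-admissible tuples, then \[|M_{\overline n}|<|M_{\overline n'}|\ \Leftrightarrow\ C(M_{\overline n})<C(M_{\overline n'}).\]
   Context: Models: a $\tau$-model with domain $W$ assigns to each $p\in\tau$ a subset of $W$ (the points where $p$ is true). $\mathcal M$ is the set of all $\tau$-models with domain $\{1,\dots,n\}$. A type over $\tau$ is a maximally consistent set of literals ($p$ or $\neg p$, $p\in\tau$); there are $t=2^{|\tau|}$ types, enumerated as $(\pi_i)_{i\in I}$, $I=\{1,\dots,t\}$. Each point of a model realizes exactly one type. Logic: propositional formulas are $\psi ::= p\mid\neg p\mid\psi\wedge\psi\mid\psi\vee\psi$ with $p\in\tau$. Formulas of $\mathrm{GMLU}$ are built from $\diamond^{\ge k}\psi$, $\blacksquare^{<k}\psi$, $\diamond^{=k}\psi$, $\blacksquare^{\ne k}\psi$ ($\psi$ propositional, $k\in\mathbb N$) by closing under $\wedge,\vee$ and under prefixing $\diamond^{\ge k},\blacksquare^{<k},\diamond^{=k},\blacksquare^{\ne k}$. Semantics at a point $w$: Boolean connectives as usual; $\diamond^{\ge k}\varphi$ (resp. $\diamond^{=k}\varphi$)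 holds iff at least (resp. exactly) $k$ points of the domain satisfy $\varphi$; $\blacksquare^{<k}\varphi$ is equivalent to $\neg\diamond^{\ge k}\neg\varphi$ and $\blacksquare^{\ne k}\varphi$ to $\neg\diamond^{=k}\neg\varphi$. Truth of a $\mathrm{GMLU}$-formula in a model does not depend on the point, so $\mathfrak M\vDash\varphi$ is well defined. $\mathrm{GMLU}_d$ is the set of formulas of counting depth at most $d$, i.e. in which every occurring $\diamond^{\ge k},\blacksquare^{<k}$ has $k\le d$ and every occurring $\diamond^{=k},\blacksquare^{\ne k}$ has $k+1\le d$. Size: literals have size $1$; $\mathrm{size}(\varphi\wedge\psi)=\mathrm{size}(\varphi\vee\psi)=\mathrm{size}(\varphi)+\mathrm{size}(\psi)+1$; $\mathrm{size}(\diamond^{\ge k}\varphi)=\mathrm{size}(\blacksquare^{<k}\varphi)=\mathrm{size}(\varphi)+k$; $\mathrm{size}(\diamond^{=k}\varphi)=\mathrm{size}(\blacksquare^{\ne k}\varphi)=\mathrm{size}(\varphi)+k+1$. A formula $\varphi$ defines $M\subseteq\mathcal M$ if for all $\mathfrak M\in\mathcal M$: $\mathfrak M\vDash\varphi\Leftrightarrow\mathfrak M\in M$. $C(M)$ is the minimum size of a $\mathrm{GMLU}_d$-formula defining $M$. Classes: $\mathfrak M\equiv_d\mathfrak N$ iff $\mathfrak M,\mathfrak N\in\mathcal M$ satisfy the same $\mathrm{GMLU}_d$-formulas. A tuple $\overline n=(n_i)_{i\in I}$ of natural numbers is $(n,d)$-admissible if $n_i\le d$ for all $i$, $\sum_i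 n_i\le n$, and either some $n_i=d$ or $\sum_i n_i=n$. $M_{\overline n}$ is the set of models in $\mathcal M$ having exactly $n_i$ points of type $\pi_i$ whenever $n_i<d$ and at least $d$ points of type $\pi_i$ whenever $n_i=d$; the map $\overline n\mapsto M_{\overline n}$ is a bijection from $(n,d)$-admissible tuples to equivalence classes of $\equiv_d$. Orders on $(n,d)$-admissible tuples: $\overline n\le_s\overline n'$ iff $\overline n=\overline n'$ or $|M_{\overline n}|<|M_{\overline n'}|$. $\overline n\le_c\overline n'$ iff $\overline n=\overline n'$ or $C(M_{\overline n})<C(M_{\overline n'})$. With $c_\tau:=2^{|\tau|}(2|\tau|+1)-1$, $\overline n\preceq_\tau\overline n'$ iff $n_i\le n_i'$ for every $i\in I$ and, moreover, either $\overline n=\overline n'$ or $\sum_{i\in I}(n_i'-n_i)>c_\tau$. *)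

(* Defs.v *)
From HB Require Import structures.
From mathcomp Require Import all_boot boolp.

Set Implicit Arguments.
Unset Strict Implicit.
Unset Printing Implicit Defensive.

(* The domain {1, ..., n} is encoded as 'I_n. *)
Definition model (tau : finType) (n : nat) := {ffun tau -> {set 'I_n}}.

(* (p, true) is the literal p and (p, false) is the literal ~ p. *)
Definition literal (tau : finType) := (tau * bool)%type.

Definition lit_sat (tau : finType) (n : nat) (A : model tau n)
    (l : literal tau) (w : 'I_n) : bool :=
  if l.2 then w \in A l.1 else w \notin A l.1.

Definition consistent (tau : finType) (S : {set literal tau}) : bool :=
  [forall p : tau, ~~ (((p, true) \in S) && ((p, false) \in S))].

Definition mtype (tau : finType) :=
  {S : {set literal tau} | maxset (@consistent tau) S}.

Definition realizes (tau : finType) (n : nat) (A : model tau n) (w : 'I_n)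
    (pi : mtype tau) : bool :=
  [forall l in val pi, lit_sat A l w].

Inductive pform (tau : finType) : Type :=
| PLit (l : literal tau)
| PAnd (psi1 psi2 : pform tau)
| POr (psi1 psi2 : pform tau).

Arguments PLit {tau} l.

Inductive modality : Type :=
| DiaGe (k : nat)
| BoxLt (k : nat)
| DiaEq (k : nat)
| BoxNe (k : nat).

Inductive gform (tau : finType) : Type :=
| GBase (m : modality) (psi : pform tau)
| GMod (m : modality) (phi : gform tau)
| GAnd (phi1 phi2 : gform tau)
| GOr (phi1 phi2 : gform tau).

Fixpoint psat (tau : finType) (n : nat) (A : model tau n) (psi : pform tau)
    (w : 'I_n) : bool :=
  match psi with
  | PLit l => lit_sat A l w
  | PAnd psi1 psi2 => psat A psi1 w && psat A psi2 w
  | POr psi1 psi2 => psat A psi1 w || psat A psi2 w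
  end.

(* S is the set of points satisfying the formula in the scope of m. *)
Definition mod_sat (n : nat) (m : modality) (S : {set 'I_n}) : bool :=
  match m with
  | DiaGe k => k <= #|S|
  | BoxLt k => ~~ (k <= #|~: S|)
  | DiaEq k => #|S| == k
  | BoxNe k => ~~ (#|~: S| == k)
  end.

Fixpoint gsat (tau : finType) (n : nat) (A : model tau n) (phi : gform tau)
    (w : 'I_n) : bool :=
  match phi with
  | GBase m psi => mod_sat m [set v | psat A psi v]
  | GMod m phi1 => mod_sat m [set v | gsat A phi1 v]
  | GAnd phi1 phi2 => gsat A phi1 w && gsat A phi2 w
  | GOr phi1 phi2 => gsat A phi1 w || gsat A phi2 w
  end.

Lemma gsat_indep (tau : finType) (n : nat) (A : model tau n) (phi : gform tau)
    (w w' : 'I_n) :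
  gsat A phi w = gsat A phi w'.
Proof. by elim: phi => //= [f1 -> f2 -> | f1 -> f2 ->]. Qed.

Definition models (tau : finType) (n : nat) (A : model tau n)
    (phi : gform tau) : bool :=
  [forall w, gsat A phi w].

(* The number k or k + 1 contributed by a modality, both to the size of a
   formula and to its counting depth. *)
Definition mod_weight (m : modality) : nat :=
  match m with
  | DiaGe k | BoxLt k => k
  | DiaEq k | BoxNe k => k.+1
  end.

Fixpoint psize (tau : finType) (psi : pform tau) : nat :=
  match psi with
  | PLit _ => 1
  | PAnd psi1 psi2 | POr psi1 psi2 => psize psi1 + psize psi2 + 1
  end.

Fixpoint gsize (tau : finType) (phi : gform tau) : nat :=
  match phi with
  | GBase m psi => psize psi + mod_weight m
  | GMod m phi1 => gsize phi1 + mod_weight m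
  | GAnd phi1 phi2 | GOr phi1 phi2 => gsize phi1 + gsize phi2 + 1
  end.

Fixpoint counting_depth (tau : finType) (phi : gform tau) : nat :=
  match phi with
  | GBase m _ => mod_weight m
  | GMod m phi1 => maxn (mod_weight m) (counting_depth phi1)
  | GAnd phi1 phi2 | GOr phi1 phi2 =>
      maxn (counting_depth phi1) (counting_depth phi2)
  end.

Definition defines (tau : finType) (n : nat) (phi : gform tau)
    (M : {set model tau n}) : Prop :=
  forall A : model tau n, models A phi <-> A \in M.

Definition definable_with_size (tau : finType) (n d : nat)
    (M : {set model tau n}) (s : nat) : Prop :=
  exists phi : gform tau,
    [/\ counting_depth phi <= d, defines phi M & gsize phi = s].

(* The value 0 is a default for classes that no formula of counting depth at
   most d defines; by definable_class_of below it is never used for class_of. *)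
Definition complexity (tau : finType) (n d : nat) (M : {set model tau n})
    : nat :=
  match pselect (exists s, `[< definable_with_size d M s >]) with
  | left ex_s => ex_minn ex_s
  | right _ => 0
  end.

(* Tuples are indexed by the types themselves instead of an enumeration. *)
Definition ntuple (tau : finType) := {ffun mtype tau -> nat}.

Definition admissible (tau : finType) (n d : nat) (nb : ntuple tau) : bool :=
  [&& [forall i, nb i <= d], \sum_i nb i <= n &
      [exists i, nb i == d] || (\sum_i nb i == n)].

Definition class_of (tau : finType) (n d : nat) (nb : ntuple tau)
    : {set model tau n} :=
  [set A : model tau n | [forall i : mtype tau,
     let c := #|[set w | realizes A w i]| in
     ((nb i < d) ==> (c == nb i)) && ((nb i == d) ==> (d <= c))]].

Definition le_s (tau : finType) (n d : nat) (nb nb' : ntuple tau) : bool :=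
  (nb == nb') || (#|class_of n d nb| < #|class_of n d nb'|).

Definition le_c (tau : finType) (n d : nat) (nb nb' : ntuple tau) : bool :=
  (nb == nb') ||
  (complexity d (class_of n d nb) < complexity d (class_of n d nb')).

Definition c_tau (tau : finType) : nat := 2 ^ #|tau| * (2 * #|tau| + 1) - 1.

Definition prec_tau (tau : finType) (nb nb' : ntuple tau) : bool :=
  [forall i, nb i <= nb' i] &&
  ((nb == nb') || (c_tau tau < \sum_i (nb' i - nb i))).

Lemma complexityP (tau : finType) (n d : nat) (M : {set model tau n}) (s : nat) :
  definable_with_size d M s ->
  definable_with_size d M (complexity d M) /\ complexity d M <= s.
Proof.
move=> Ms; rewrite /complexity; case: pselect => [ex_s | []]; last first.
  by exists s; apply/asboolP.
case: ex_minnP => m /asboolP Mm min_m; split=> //.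
by apply: min_m; apply/asboolP.
Qed.

Lemma type_lit (tau : finType) (pi : mtype tau) (p : tau) :
  ((p, true) \in val pi) (+) ((p, false) \in val pi).
Proof.
case: pi => S /= /maxsetP[cS maxS].
have := forallP cS p; case pT: ((p, true) \in S); case pF: ((p, false) \in S) => // _.
suff: (p, true) \in S by rewrite pT.
rewrite -(maxS ((p, true) |: S)) ?setU11 ?subsetU1 //; apply/forallP=> q.
rewrite !inE !xpair_eqE /= andbT andbF /=; have := forallP cS q.
by case: eqP => [-> | _]; rewrite ?pF ?orbF.
Qed.

Lemma lit_type_subproof (tau : finType) (B : {set tau}) :
  maxset (@consistent tau) [set l | l.2 == (l.1 \in B)].
Proof.
apply/maxsetP; split=> [|S cS sub_S].
  by apply/forallP=> p; rewrite !inE /=; case: (p \in B).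
apply/eqP; rewrite eqEsubset sub_S andbT; apply/subsetP=> -[p b] pbS.
rewrite inE /=; apply/contraT=> neq.
have := forallP cS p; have : (p, ~~ b) \in S.
  by apply: (subsetP sub_S); rewrite inE /=; case: (p \in B) neq; case: (b).
by case: b pbS {neq} => /= -> ->.
Qed.

Definition type_of_set (tau : finType) (B : {set tau}) : mtype tau :=
  exist (fun S => maxset (@consistent tau) S) _ (lit_type_subproof B).

Lemma card_mtype (tau : finType) : #|{: mtype tau}| = 2 ^ #|tau|.
Proof.
rewrite -cardsT -card_powerset powersetT.
have inj : injective (@type_of_set tau).
  move=> B C /(congr1 val) /= /setP eBC; apply/setP=> p.
  by have := eBC (p, true); rewrite !inE /= !(eq_sym true) !eqb_id.
rewrite !cardsT -(card_codom inj); apply/eq_card => pi; apply/esym.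
apply/codomP; exists [set p | (p, true) \in val pi]; apply/val_inj/setP=> -[p b].
rewrite !inE /=; have := type_lit pi p.
by case: b; case: (_ \in val pi); case: (_ \in val pi).
Qed.

Lemma psat_conj (tau : finType) (n : nat) (A : model tau n) (w : 'I_n) psi s :
  psat A (foldr (@PAnd tau) psi s) w = psat A psi w && all (psat A ^~ w) s.
Proof. by elim: s => [|x s IHs] /=; rewrite ?andbT // IHs andbCA. Qed.

Lemma gsat_conj (tau : finType) (n : nat) (A : model tau n) (w : 'I_n) phi s :
  gsat A (foldr (@GAnd tau) phi s) w = gsat A phi w && all (gsat A ^~ w) s.
Proof. by elim: s => [|x s IHs] /=; rewrite ?andbT // IHs andbCA. Qed.

Lemma type_formula (tau : finType) (pi : mtype tau) : 0 < #|tau| ->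
  exists psi : pform tau, forall n (A : model tau n) w,
    psat A psi w = realizes A w pi.
Proof.
case/card_gt0P=> p _.
case E: (enum (val pi)) => [|l s].
  by have := type_lit pi p; rewrite -!(mem_enum (val pi)) E.
exists (foldr (@PAnd tau) (PLit l) (map PLit s)) => n A w.
rewrite psat_conj all_map /=.
apply/idP/forall_inP => [/andP[Al /allP As] l' | Api].
  by rewrite -mem_enum E inE => /predU1P[-> // | /As].
apply/andP; split; first by rewrite Api // -mem_enum E mem_head.
by apply/allP => l' l's /=; rewrite Api // -mem_enum E inE l's orbT.
Qed.

Lemma definable_class_of (tau : finType) (n d : nat) (nb : ntuple tau) :
  0 < #|tau| -> 0 < n -> admissible n d nb ->
  exists s, definable_with_size d (class_of n d nb) s.
Proof.
move=> tau_gt0 n_gt0 /andP[/forallP le_d _].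
pose psi i := projT1 (cid (type_formula i tau_gt0)).
have psiE i A w : psat A (psi i) w = realizes A w i.
  by rewrite /psi; case: cid => /= x; apply.
pose f i := GBase (if nb i < d then DiaEq (nb i) else DiaGe d) (psi i).
have fd i : counting_depth (f i) <= d by rewrite /=; case: ifP.
case E: (enum {: mtype tau}) => [|i0 s].
  by have := card_mtype tau; rewrite cardE E => /esym/eqP; rewrite expn_eq0.
pose phi := foldr (@GAnd tau) (f i0) (map f s).
exists (gsize phi), phi; split=> // [|A].
  by rewrite /phi; elim: (s) => [|i s' IH]; [exact: fd|rewrite /= geq_max IH andbT fd].
have fE i w : gsat A (f i) w =
    (let c := #|[set w | realizes A w i]| in
     ((nb i < d) ==> (c == nb i)) && ((nb i == d) ==> (d <= c))).
  rewrite /=; under eq_finset do rewrite psiE.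
  by have := le_d i; case: ltngtP => //= _ _; rewrite ?andbT.
have allE w : gsat A phi w = (A \in class_of n d nb).
  have -> : gsat A phi w = all (fun i => gsat A (f i) w) (enum {: mtype tau}).
    by rewrite gsat_conj all_map E.
  rewrite inE; apply/allP/forallP => H i; first by rewrite -(fE i w) H ?mem_enum.
  by move=> _; rewrite fE; apply: H.
by split=> [/forallP/(_ (Ordinal n_gt0)) | H]; rewrite -?(allE (Ordinal n_gt0)) //;
   apply/forallP=> w; rewrite allE.
Qed.

(* Main.v *)
Require Import Defs.
From mathcomp Require Import all_boot.
From mathcomp Require Import zify.

(** Write M for the class of nb and M' for the class of nb', where nb is
    strictly below nb'. If n exceeds the number of types times d, every
    admissible tuple has an entry equal to d.

    Cardinality. It is enough to raise one entry, at a type i, by one. In a model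
    of M all but boundedly many points have a type carried by more than d points;
    giving any of these points the type i leads to a model of the next class. A
    model of that class is reached in a bounded number of ways, because it has
    at most d points of type i that could have been changed, and boundedly many
    types they could have had before. So the size of the class is multiplied by
    at least a constant times n ([card_class_incr]), and chains of such steps give
    strict growth ([card_class_mono]).

    Complexity. Call a type constrained if some other type has entry d in nb'.
    A formula defining M' must, for each constrained type i, notice when one point
    of type i is moved to a type j with entry d, starting from a model with the
    least possible number of points of each type other than j. Its truth
    value then changes at some atom, that is, at a modality in front of a
    propositional formula. This atom counts a set of types that contains i but
    not j, since a count involving the abundant type j is out of reach of
    counting depth d. As the count drops by one across the threshold of the
    modality, the weight of the modality is at least the sum of the entries of
    nb' over the counted set ([atom_counts_type]). The counted sets cover the
    constrained types with nonzero entry, so the formula has size at least the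
    sum of the entries of nb' over the constrained types ([gsize_ge]).

    Conversely, M is defined by a conjunction of one counting formula for each of
    these types: if only one type is left out, its entry is d and n is so
    large that it takes up all the remaining points. The size of this conjunction
    exceeds the sum of the entries of nb over these types by at most c_tau
    ([complexity_le]). On types that are not constrained nb and nb' agree, so
    the hypothesis on the sum of differences separates the two bounds
    ([complexity_lt]). *)

Set Implicit Arguments.
Unset Strict Implicit.
Unset Printing Implicit Defensive.

(** * Types of points and changes of type *)

(** A name of its own keeps every occurrence of this cardinal syntactically
    equal, as linear arithmetic requires. *)
Definition ntypes (tau : finType) : nat := #|{: mtype tau}|.

Definition point_type (tau : finType) (n : nat) (A : model tau n) (w : 'I_n)
    : mtype tau :=
  type_of_set [set p | w \in A p].

Lemma mem_point_type (tau : finType) (n : nat) (A : model tau n) (w : 'I_n) l :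
  (l \in val (point_type A w)) = lit_sat A l w.
Proof. by rewrite /lit_sat !inE; case: l => p [] /=; case: (w \in A p). Qed.

(** Types are maximal consistent sets, so a type contained in the consistent set
    of all literals true at w is that set. *)
Lemma realizesE (tau : finType) (n : nat) (A : model tau n) (w : 'I_n) i :
  realizes A w i = (point_type A w == i).
Proof.
apply/forall_inP/eqP => [Ai | <- l]; last by rewrite mem_point_type.
case: i Ai => S maxS /= Ai; have [_ S_max] := maxsetP maxS.
apply/val_inj/S_max; first by have [] := maxsetP (valP (point_type A w)).
by apply/subsetP=> l /Ai; rewrite -mem_point_type.
Qed.

Lemma point_type_inj (tau : finType) (n : nat) (A B : model tau n) :
  point_type A =1 point_type B -> A = B.
Proof.
move=> eAB; apply/ffunP=> p; apply/setP=> w.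
by have := mem_point_type A w (p, true); rewrite eAB mem_point_type.
Qed.

Definition retype (tau : finType) (n : nat) (A : model tau n) (w : 'I_n)
    (i : mtype tau) : model tau n :=
  [ffun p => if (p, true) \in val i then w |: A p else A p :\ w].

Lemma point_type_retype (tau : finType) (n : nat) (A : model tau n) w i v :
  point_type (retype A w i) v = if v == w then i else point_type A v.
Proof.
case: eqP => [-> | /eqP neq_vw].
  apply/eqP; rewrite -realizesE; apply/forall_inP=> -[p b].
  rewrite /lit_sat ffunE; have := type_lit i p.
  case: b => /= + pb; rewrite pb.
    by rewrite !inE eqxx.
  by rewrite addbT => /negPf->; rewrite !inE eqxx.
apply/val_inj/setP=> -[p b]; rewrite !mem_point_type /lit_sat ffunE /=.
by case: (_ \in val i); rewrite !inE (negPf neq_vw).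
Qed.

Lemma retypeK (tau : finType) (n : nat) (A : model tau n) w i :
  retype (retype A w i) w (point_type A w) = A.
Proof.
by apply/point_type_inj=> v; rewrite !point_type_retype; case: eqP => [-> |].
Qed.

Definition tcount (tau : finType) (n : nat) (A : model tau n)
    (T : {set mtype tau}) : nat :=
  #|[set w | point_type A w \in T]|.

(** Both sides are stated as sums so that no truncated subtraction appears. *)
Lemma tcount_retype (tau : finType) (n : nat) (A : model tau n) w i T :
  tcount (retype A w i) T + (point_type A w \in T) = tcount A T + (i \in T).
Proof.
rewrite /tcount (cardsD1 w) [in RHS](cardsD1 w) !inE point_type_retype eqxx.
have -> : [set v | point_type (retype A w i) v \in T] :\ w
        = [set v | point_type A v \in T] :\ w.
  by apply/setP=> v; rewrite !inE point_type_retype; case: eqP.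
lia.
Qed.

(** The special case of a single type is kept folded, for the same reason as
    [ntypes]. *)
Definition cell (tau : finType) (n : nat) (A : model tau n) (i : mtype tau)
    : nat :=
  tcount A [set i].

Lemma cell_retype (tau : finType) (n : nat) (A : model tau n) w i k :
  cell (retype A w i) k + (point_type A w == k) = cell A k + (i == k).
Proof. by have := tcount_retype A w i [set k]; rewrite !inE. Qed.

Lemma tcount_sum (tau : finType) (n : nat) (A : model tau n) T :
  tcount A T = \sum_(l in T) cell A l.
Proof.
rewrite /tcount -sum1_card (partition_big (point_type A) (mem T)) => [|w]; last first.
  by rewrite inE.
apply: eq_bigr => l Tl; rewrite -[RHS]sum1_card; apply: eq_bigl => w.
by rewrite !inE andb_idl // => /eqP->.
Qed.

Lemma tcount_setT (tau : finType) (n : nat) (A : model tau n) :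
  tcount A setT = n.
Proof. by rewrite /tcount -[RHS]card_ord -cardsT; apply: eq_card => w; rewrite !inE. Qed.

(** Both clauses in the definition of a class say that the entry is the count
    truncated at d; this form makes the case distinction implicit. *)
Lemma class_ofP (tau : finType) (n d : nat) (nb : ntuple tau) (A : model tau n) :
  (forall i, nb i <= d) ->
  reflect (forall i, minn (cell A i) d = nb i) (A \in class_of n d nb).
Proof.
move=> le_d; rewrite inE; apply: (equivP forallP).
have tcountE i : #|[set w | realizes A w i]| = cell A i.
  by apply: eq_card => w; rewrite !inE realizesE.
have truncE i : ((nb i < d) ==> (cell A i == nb i)) &&
    ((nb i == d) ==> (d <= cell A i)) = (minn (cell A i) d == nb i).
  by have := le_d i; case: ltngtP => //= ? _; lia.
by split=> H i; have := H i; rewrite /= tcountE truncE => /eqP.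
Qed.

(** * Larger tuples have larger classes *)

Definition incr (tau : finType) (nb : ntuple tau) (i : mtype tau) : ntuple tau :=
  [ffun k => nb k + (k == i)].

(** Each type carried by at most d points excludes at most d points. *)
Lemma card_crowded_points (tau : finType) (n d : nat) (A : model tau n) :
  n - ntypes tau * d <= #|[set w | d < cell A (point_type A w)]|.
Proof.
set G := [set w | _]; suff: #|~: G| <= ntypes tau * d.
  by have := cardsC G; rewrite card_ord; lia.
rewrite -sum1_card (partition_big (point_type A) predT) //=.
rewrite -sum_nat_const; apply: leq_sum => l _; rewrite sum1dep_card.
have [le_d | gt_d] := leqP (cell A l) d.
  apply: leq_trans le_d; apply: subset_leq_card; apply/subsetP=> w.
  by rewrite !inE => /andP[].
rewrite (_ : [set _ | _] = set0) ?cards0 //; apply/setP=> w; rewrite !inE.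
by case: eqP => [-> | _]; rewrite ?gt_d ?andbF.
Qed.

Lemma card_pairs (T U : finType) (M : {set T}) (G : T -> {set U}) :
  #|[set x : T * U | (x.1 \in M) && (x.2 \in G x.1)]| = \sum_(A in M) #|G A|.
Proof.
rewrite -sum1_card (eq_bigr (fun A => \sum_(w in G A) 1)); last first.
  by move=> A _; rewrite sum1_card.
by rewrite pair_big_dep; apply: eq_bigl => x; rewrite inE.
Qed.

(** Double counting of the pairs of a model of the first class and a point that
    shares its type with at least d others. Giving such a point the type i is
    injective once the point and its old type are remembered, and it lands in the
    second class. *)
Lemma card_class_incr (tau : finType) (n d : nat) (nb : ntuple tau) i :
  (forall k, nb k <= d) -> nb i < d ->
  #|class_of n d nb| * (n - ntypes tau * d)
    <= #|class_of n d (incr nb i)| * (d * ntypes tau).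
Proof.
move=> le_d lt_d.
have le_d' k : incr nb i k <= d.
  by rewrite ffunE; case: eqP => [->|_]; have := le_d k; lia.
(* H lists the possible traces of a change: the changed point and its old
   type. Models with more than d points of type i are not reached, since the
   count of i grows from nb i < d by one. *)
pose G (A : model tau n) := [set w | d < cell A (point_type A w)].
pose H (A : model tau n) := [set x : 'I_n * mtype tau |
  (point_type A x.1 == i) && (cell A i <= d)].
pose f (x : model tau n * 'I_n) := (retype x.1 x.2 i, (x.2, point_type x.1 x.2)).
have f_inj : injective f.
  move=> [A w] [B v] /(congr1 (fun y => (retype y.1 y.2.1 y.2.2, y.2.1))).
  by rewrite /= !retypeK.
apply: (@leq_trans (\sum_(A in class_of n d nb) #|G A|)).
  by rewrite -sum_nat_const; apply: leq_sum => A _; apply: card_crowded_points.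
apply: (@leq_trans (\sum_(A in class_of n d (incr nb i)) #|H A|)); last first.
  rewrite -sum_nat_const; apply: leq_sum => A _.
  have [le_c | gt_c] := leqP (cell A i) d; last first.
    rewrite (_ : H A = set0) ?cards0 //; apply/setP=> x.
    by rewrite !inE leqNgt gt_c andbF.
  rewrite (_ : H A = setX [set w | point_type A w \in [set i]] setT); last first.
    by apply/setP=> x; rewrite !inE le_c !andbT.
  by rewrite cardsX cardsT leq_mul2r le_c orbT.
rewrite -!card_pairs -(card_imset _ f_inj); apply: subset_leq_card.
apply/subsetP=> _ /imsetP[[A w] + ->]; rewrite inE /= => /andP[/(class_ofP _ le_d) nbA].
rewrite inE /= => Gw; rewrite inE /= [_ \in H _]inE /=.
have Ai := nbA i; rewrite point_type_retype eqxx /=.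
have cnt k := cell_retype A w i k.
have neq_i : point_type A w != i by apply: contraTneq Gw => ->; rewrite -leqNgt; lia.
apply/andP; split; last by have := cnt i; rewrite eqxx (negPf neq_i); lia.
apply/(class_ofP _ le_d')=> k; rewrite ffunE -nbA eq_sym.
have := cnt k; case: (i =P k) => [<- | _]; first by lia.
by case: eqP => [<- | _]; lia.
Qed.

(** Induction on the distance between the tuples, through unit steps. The
    assumption that the first class is nonempty is needed for strictness, since a
    step only multiplies the cardinal by a factor above 1. *)
Lemma card_class_mono (tau : finType) (n d : nat) (nb nb' : ntuple tau) :
  2 * (ntypes tau * d) < n ->
  (forall k, nb' k <= d) -> (forall k, nb k <= nb' k) ->
  0 < #|class_of n d nb| ->
  #|class_of n d nb| + (nb != nb') <= #|class_of n d nb'|.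
Proof.
move=> n_gt le_d; move s_def: (\sum_i (nb' i - nb i)) => s.
elim: s nb s_def => [|s IHs] nb s_def le_nb M_gt0.
  suff -> : nb = nb' by rewrite eqxx addn0.
  apply/ffunP=> k; apply/eqP; rewrite eqn_leq le_nb /= -subn_eq0.
  by move/eqP: s_def; rewrite sum_nat_eq0 => /forallP/(_ k).
have [k lt_k | nb_ge] := pickP (fun k => nb k < nb' k); last first.
  by move: s_def; rewrite big1 // => k _; have := nb_ge k; lia.
have le_i l : incr nb k l <= nb' l.
  by rewrite ffunE; case: eqP => [->|_]; rewrite ?addn1 ?addn0 ?lt_k.
have step : #|class_of n d nb| < #|class_of n d (incr nb k)|.
  have := @card_class_incr tau n d nb k (fun l => leq_trans (le_nb l) (le_d l))
     (leq_trans lt_k (le_d k)).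
  rewrite [d * _]mulnC; set t := _ * d in n_gt *; nia.
have := IHs (incr nb k) _ le_i (leq_ltn_trans (leq0n _) step).
suff -> : \sum_i (nb' i - incr nb k i) = s.
  move/(_ erefl) => le_M; apply: leq_trans (leq_trans (leq_addr _ _) le_M).
  by case: (nb != nb'); rewrite ?addn1 ?addn0 // ltnW.
move: s_def; rewrite (bigD1 k) //= (bigD1 k (F := fun i => nb' i - incr nb k i)) //=.
under [X in _ -> _ + X = _]eq_bigr => l /negPf nlk do rewrite ffunE nlk addn0.
rewrite ffunE eqxx addn1 subnS => s_def.
by apply: succn_inj; rewrite -s_def -addSn prednK ?subn_gt0.
Qed.

(** The model whose points all have type j realizes the tuple that is d at j
    and 0 elsewhere, and classes only grow from there. *)
Lemma class_of_gt0 (tau : finType) (n d : nat) (nb : ntuple tau) j :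
  2 * (ntypes tau * d) < n -> (forall k, nb k <= d) -> nb j = d ->
  0 < #|class_of n d nb|.
Proof.
move=> n_gt le_d nbj.
pose e : ntuple tau := [ffun k => if k == j then d else 0].
pose A : model tau n := [ffun p => if (p, true) \in val j then setT else set0].
have Aj w : point_type A w = j.
  apply/eqP; rewrite -realizesE; apply/forall_inP=> -[p b].
  rewrite /lit_sat ffunE; have := type_lit j p.
  case: b => /= + pb; rewrite pb.
    by rewrite !inE.
  by rewrite addbT => /negPf->; rewrite !inE.
have t_gt0 : 0 < ntypes tau by apply/card_gt0P; exists j.
have eM : A \in class_of n d e.
  apply/class_ofP=> k; first by rewrite ffunE; case: ifP.
  rewrite ffunE; have := tcount_setT A.
  have -> : tcount A setT = cell A j by apply: eq_card => w; rewrite !inE Aj eqxx.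
  case: eqP => [-> | nkj]; first by nia.
  rewrite (_ : cell A k = 0) ?min0n //.
  by apply: eq_card0 => w; rewrite !inE Aj; apply/eqP=> /esym.
have e_gt0 : 0 < #|class_of n d e| by apply/card_gt0P; exists A.
have le_e k : e k <= nb k by rewrite ffunE; case: eqP => [-> | _]; rewrite ?nbj.
have := card_class_mono n_gt le_d le_e e_gt0; lia.
Qed.

(** * Every defining formula is large *)

Fixpoint ptypes (tau : finType) (psi : pform tau) : {set mtype tau} :=
  match psi with
  | PLit l => [set i : mtype tau | l \in val i]
  | PAnd psi1 psi2 => ptypes psi1 :&: ptypes psi2
  | POr psi1 psi2 => ptypes psi1 :|: ptypes psi2
  end.

Lemma psatE (tau : finType) (n : nat) (A : model tau n) psi w :
  psat A psi w = (point_type A w \in ptypes psi).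
Proof.
elim: psi => [l | f1 IH1 f2 IH2 | f1 IH1 f2 IH2] /=.
- by rewrite [RHS]in_set mem_point_type.
- by rewrite in_setI IH1 IH2.
- by rewrite in_setU IH1 IH2.
Qed.

(** Nested modalities are dropped: they apply to sentences whose truth value is
    already determined by the atoms below. *)
Fixpoint atoms (tau : finType) (phi : gform tau) : seq (modality * pform tau) :=
  match phi with
  | GBase m psi => [:: (m, psi)]
  | GMod _ phi1 => atoms phi1
  | GAnd phi1 phi2 | GOr phi1 phi2 => atoms phi1 ++ atoms phi2
  end.

Definition atom_sat (tau : finType) (n : nat) (A : model tau n)
    (a : modality * pform tau) : bool :=
  mod_sat a.1 [set v | psat A a.2 v].

Lemma gsat_atoms (tau : finType) (n : nat) (A B : model tau n) phi w :
  all (fun a => atom_sat A a == atom_sat B a) (atoms phi) ->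
  gsat A phi w = gsat B phi w.
Proof.
elim: phi w => [m psi | m f IHf | f1 IH1 f2 IH2 | f1 IH1 f2 IH2] w /=.
- by rewrite andbT => /eqP.
- by move=> eq_f; congr mod_sat; apply/setP=> v; rewrite !inE IHf.
- by rewrite all_cat => /andP[/IH1-> /IH2->].
- by rewrite all_cat => /andP[/IH1-> /IH2->].
Qed.

Lemma sum_weight_le_gsize (tau : finType) (phi : gform tau) :
  \sum_(a <- atoms phi) mod_weight a.1 <= gsize phi.
Proof.
elim: phi => [m psi | m f IHf | f1 IH1 f2 IH2 | f1 IH1 f2 IH2] /=.
- by rewrite big_seq1 leq_addl.
- exact: leq_trans IHf (leq_addr _ _).
- by rewrite big_cat /=; lia.
- by rewrite big_cat /=; lia.
Qed.

Lemma weight_le_depth (tau : finType) (d : nat) (phi : gform tau) :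
  counting_depth phi <= d -> all (fun a => mod_weight a.1 <= d) (atoms phi).
Proof.
elim: phi => [m psi | m f IHf | f1 IH1 f2 IH2 | f1 IH1 f2 IH2] /=.
- by rewrite andbT.
- by rewrite geq_max => /andP[_ /IHf].
- by rewrite geq_max all_cat => /andP[/IH1-> /IH2].
- by rewrite geq_max all_cat => /andP[/IH1-> /IH2].
Qed.

(** The boxes compare the number of points that falsify their argument with the
    threshold, hence the complement. *)
Definition counted (tau : finType) (a : modality * pform tau) : {set mtype tau} :=
  match a.1 with
  | DiaGe _ | DiaEq _ => ptypes a.2
  | BoxLt _ | BoxNe _ => ~: ptypes a.2
  end.

(** If the modality compares the count with k by an inequality, the smaller of
    the two counts is below k, the weight. If it tests equality with k, one of the
    counts is k, below the weight k + 1. *)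
Lemma atom_flip (tau : finType) (n : nat) (A B : model tau n) a :
  atom_sat A a != atom_sat B a ->
  tcount A (counted a) != tcount B (counted a) /\
  minn (tcount A (counted a)) (tcount B (counted a)) < mod_weight a.1.
Proof.
have S_E (C : model tau n) psi : #|[set v | psat C psi v]| = tcount C (ptypes psi).
  by apply: eq_card => v; rewrite !inE psatE.
have SC_E (C : model tau n) psi : #|~: [set v | psat C psi v]| = tcount C (~: ptypes psi).
  by apply: eq_card => v; rewrite !inE psatE.
by case: a => -[] k psi; rewrite /atom_sat /counted /= ?S_E ?SC_E; lia.
Qed.

(** The formula separates two models A and B, where B arises from A by moving one
    point of type i to type j, and A has exactly nb k points of each type k other
    than j. This makes the count of i fall below its entry, whether
    that entry prescribes an exact number or the lower bound d. *)
Lemma atom_counts_type (tau : finType) (n d : nat) (nb : ntuple tau) phi i j :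
  2 * (ntypes tau * d.+1) < n -> (forall k, nb k <= d) ->
  nb j = d -> j != i -> 0 < nb i ->
  counting_depth phi <= d -> defines phi (class_of n d nb) ->
  has (fun a => (i \in counted a) && (\sum_(l in counted a) nb l <= mod_weight a.1))
      (atoms phi).
Proof.
move=> n_gt le_d nbj neq_ji nbi_gt0 phi_d phiP.
(* A model with exact counts is one of a class at depth d + 1: all entries but
   the one at j are below d + 1. It also has more than d points of type j, so
   that atoms counting j are true or false in A and B alike. *)
pose nb1 := incr nb j.
have nb1_le k : nb1 k <= d.+1 by rewrite ffunE; case: eqP => [->|_]; have := le_d k; lia.
have nb1j : nb1 j = d.+1 by rewrite ffunE eqxx nbj addn1.
have [A /(class_ofP _ nb1_le) nb1A] := card_gt0P (class_of_gt0 n_gt nb1_le nb1j).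
have cntA k : k != j -> cell A k = nb k.
  by move=> /negPf nkj; have := nb1A k; rewrite ffunE nkj; have := le_d k; lia.
have cntAj : d < cell A j by have := nb1A j; rewrite nb1j; lia.
have M_A : A \in class_of n d nb.
  apply/(class_ofP _ le_d)=> k; have := le_d k.
  by case: (eqVneq k j) => [-> | /cntA ->]; lia.
have [w wi] : exists w, point_type A w = i.
  have : 0 < cell A i by rewrite cntA // eq_sym.
  by case/card_gt0P=> w; rewrite !inE => /eqP; exists w.
pose B := retype A w j; have cntB T := tcount_retype A w j T.
have M_B : B \notin class_of n d nb.
  apply/(class_ofP _ le_d)=> /(_ i); have := cell_retype A w j i.
  by rewrite -/B wi eqxx (negPf neq_ji) cntA 1?eq_sym //; have := le_d i; lia.
have n_gt0 : 0 < n by lia.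
pose w0 := Ordinal n_gt0.
have models_E C : models C phi = gsat C phi w0.
  by apply/forallP/idP => [/(_ w0) // | sat_C v]; rewrite (gsat_indep _ _ _ w0).
apply: contraR M_B; rewrite -all_predC => no_atom.
suff /(gsat_atoms w0) : all (fun a => atom_sat A a == atom_sat B a) (atoms phi).
  by rewrite -!models_E => eAB; apply/phiP; rewrite -eAB; apply/phiP.
have := conj no_atom (weight_le_depth phi_d) => /andP.
rewrite -all_predI; apply: sub_all => a /= /andP[+ w_le].
apply: contraR => /atom_flip[neq_c lt_c].
have nja : j \notin counted a.
  apply/negP=> ja; have := cntB (counted a); rewrite -/B ja.
  suff : d < tcount A (counted a) by lia.
  by apply: (leq_trans cntAj); apply: subset_leq_card; apply/subsetP=> v;
     rewrite !inE => /eqP->.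
have := cntB (counted a); rewrite -/B wi (negPf nja) addn0.
case: (i \in counted a) => cB; last by lia.
rewrite (_ : \sum_(l in _) nb l = tcount A (counted a)) /=; first by lia.
rewrite tcount_sum; apply: eq_bigr => l la; rewrite cntA //.
by apply: contraNneq nja => <-.
Qed.

(** If j is the only type with entry d, its points are those left over by the
    other types, and a formula need not mention it; j is then the only type
    outside this set. With two or more such types the set is everything. *)
Definition constrained (tau : finType) (d : nat) (nb : ntuple tau)
    : {set mtype tau} :=
  [set i | [exists j, (j != i) && (nb j == d)]].

(** Charge each entry nb i to the atoms that count i and have weight at least
    the sum over their counted set: every nonzero entry at a constrained type is
    charged at least once, and no atom is charged more than its weight. *)
Lemma gsize_ge (tau : finType) (n d : nat) (nb : ntuple tau) phi :
  2 * (ntypes tau * d.+1) < n -> (forall k, nb k <= d) ->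
  counting_depth phi <= d -> defines phi (class_of n d nb) ->
  \sum_(i in constrained d nb) nb i <= gsize phi.
Proof.
move=> n_gt le_d phi_d phiP; apply: leq_trans (sum_weight_le_gsize phi).
pose P a i := (i \in counted a) && (\sum_(l in counted a) nb l <= mod_weight a.1).
apply: (@leq_trans (\sum_(i in constrained d nb) \sum_(a <- atoms phi | P a i) nb i)).
  apply: leq_sum => i; rewrite inE => /existsP[j /andP[neq_ji /eqP nbj]].
  have [-> // | nbi_gt0] := posnP (nb i).
  have := atom_counts_type n_gt le_d nbj neq_ji nbi_gt0 phi_d phiP.
  rewrite -/(P ^~ i) has_count big_const_seq iter_addn_0 => c_gt0.
  exact: leq_pmulr.
rewrite (exchange_big_dep predT) //=; apply: leq_sum => a _.
have [le_w | gt_w] := leqP (\sum_(l in counted a) nb l) (mod_weight a.1).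
  apply: leq_trans (le_w); rewrite [leqRHS](bigID (mem (constrained d nb))) /=.
  apply: leq_trans (leq_addr _ _); apply/eq_leq/eq_bigl => i.
  by rewrite /P le_w andbT andbC.
by rewrite big1 // => i; rewrite /P leqNgt gt_w !andbF.
Qed.

(** * Every class has a short definition *)

(** A conjunction of one literal for each symbol, with #|tau| literals and
    #|tau| - 1 connectives. *)
Lemma type_formula_size (tau : finType) (i : mtype tau) : 0 < #|tau| ->
  exists2 psi : pform tau, psize psi + 1 = 2 * #|tau| &
    forall n (A : model tau n) w, psat A psi w = (point_type A w == i).
Proof.
pose lit p := (p, (p, true) \in val i) : literal tau.
have litP n (A : model tau n) w p :
    lit_sat A (lit p) w = ((w \in A p) == ((p, true) \in val i)).
  by rewrite /lit_sat /=; case: (_ \in val i); rewrite ?eqb_id ?eqbF_neg.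
case E: (enum tau) => [|p0 s]; first by rewrite cardE E.
move=> _; exists (foldr (@PAnd tau) (PLit (lit p0)) [seq PLit (lit p) | p <- s]).
  rewrite cardE E /=; elim: (s) => //= p s' IH; lia.
move=> n A w; rewrite psat_conj all_map -realizesE.
apply/andP/forall_inP => [[A0 /allP As] [p b] il | Ai].
  have Ap : lit_sat A (lit p) w.
    have : p \in enum tau by rewrite mem_enum.
    by rewrite E inE => /predU1P[-> // | /As].
  have := type_lit i p; move: Ap; rewrite litP /lit_sat /=.
  by case: b il => ->; [rewrite eqb_id | rewrite addbT => /eqP->].
have Alit p : lit_sat A (lit p) w.
  apply: Ai; have := type_lit i p; rewrite /lit.
  by case: ((p, true) \in _) / boolP => [|_] //=.
by split; first exact: Alit; apply/allP=> p _; apply: Alit.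
Qed.

Lemma gsize_conj (tau : finType) (phi : gform tau) s :
  gsize (foldr (@GAnd tau) phi s) + 1 = \sum_(f <- phi :: s) (gsize f + 1).
Proof.
rewrite big_cons; elim: s => [|f s IHs] /=; first by rewrite big_nil addn0.
by rewrite big_cons addnCA -IHs; lia.
Qed.

(** The definition is the conjunction over S of the formulas saying that the
    number of points of type i is exactly nb i, or at least d. Each conjunct costs
    at most nb i + 1 for the modality and 2 #|tau| - 1 for the type, to which one
    connective is added for all but one of at most 2 ^ #|tau| conjuncts. *)
Lemma complexity_le (tau : finType) (n d : nat) (nb : ntuple tau)
    (S : {set mtype tau}) :
  0 < #|tau| -> 0 < n -> (forall k, nb k <= d) -> S != set0 ->
  (forall A : model tau n, (forall i, i \in S -> minn (cell A i) d = nb i) ->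
     A \in class_of n d nb) ->
  complexity d (class_of n d nb) <= \sum_(i in S) nb i + c_tau tau.
Proof.
move=> tau_gt0 n_gt0 le_d S_n0 S_imp.
have [psi psi_size psiE] : exists2 psi : mtype tau -> pform tau,
    forall i, psize (psi i) + 1 = 2 * #|tau| &
    forall i n (A : model tau n) w, psat A (psi i) w = (point_type A w == i).
  exact: (fin_all_exists2 (fun i => type_formula_size i tau_gt0)).
pose m i := if nb i < d then DiaEq (nb i) else DiaGe d.
pose f i := GBase (m i) (psi i).
have m_le i : mod_weight (m i) <= (nb i).+1.
  by rewrite /m; case: ltnP => // ge; have := le_d i; rewrite /=; lia.
have m_d i : mod_weight (m i) <= d by rewrite /m; case: ltnP.
have f_size i : gsize (f i) + 1 <= nb i + (2 * #|tau| + 1).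
  rewrite -(psi_size i) [gsize _]/(psize (psi i) + mod_weight (m i)).
  by have := m_le i; lia.
have fE A i w : gsat A (f i) w = (@minn (@cell tau n A i) d == nb i).
  have cellE : #|[set v | psat A (psi i) v]| = cell A i.
    by apply: eq_card => v; rewrite !inE psiE.
  by rewrite /f /m /=; have := le_d i; case: ltnP => lt_nb /=; rewrite cellE; lia.
have eS := mem_enum S; case E: (enum S) eS => [|i0 s] eS.
  by case/set0Pn: S_n0 => i; rewrite -eS.
pose phi := foldr (@GAnd tau) (f i0) [seq f i | i <- s].
have phi_size : gsize phi + 1 <= \sum_(i in S) nb i + #|S| * (2 * #|tau| + 1).
  rewrite -sum_nat_const -big_split -big_enum E.
  by rewrite gsize_conj -map_cons big_map; apply: leq_sum => i _; apply: f_size.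
have def_phi : definable_with_size d (class_of n d nb) (gsize phi).
  exists phi; split=> // [|A].
    rewrite /phi; elim: (s) => [|i s' IH]; first exact: m_d.
    by rewrite /= geq_max m_d.
  have phiE w : gsat A phi w = (A \in class_of n d nb).
    rewrite gsat_conj all_map.
    apply/idP/idP => [/andP[A0 /allP As] | MA].
      by apply: S_imp => i; rewrite -eS inE => /predU1P[-> | /As Ai];
         apply/eqP; rewrite -(fE A _ w).
    have {}MA i : gsat A (f i) w by rewrite fE; apply/eqP; move: i; apply/class_ofP.
    by rewrite MA; apply/allP=> i _; apply: MA.
  split=> [/forallP/(_ (Ordinal n_gt0)) | MA]; first by rewrite phiE.
  by apply/forallP=> w; rewrite phiE.
have [_ le_C] := complexityP def_phi; apply: leq_trans le_C _.
have le_S : #|S| * (2 * #|tau| + 1) <= 2 ^ #|tau| * (2 * #|tau| + 1).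
  by rewrite leq_mul2r -card_mtype max_card orbT.
by rewrite /c_tau; lia.
Qed.

(** * Comparison of complexities *)

(** The set of constrained types of the larger tuple is used in both bounds:
    it is enough to describe the smaller class too, because any type
    outside it has entry d in both tuples. *)
Lemma complexity_lt (tau : finType) (n d : nat) (nb nb' : ntuple tau) j :
  0 < #|tau| -> 2 * (ntypes tau * d.+1) < n ->
  (forall k, nb' k <= d) -> (forall k, nb k <= nb' k) -> nb j = d ->
  admissible n d nb' ->
  c_tau tau < \sum_i (nb' i - nb i) ->
  complexity d (class_of n d nb) < complexity d (class_of n d nb').
Proof.
move=> tau_gt0 n_gt le_d' le_nb nbj adm' gt_c.
have le_d k : nb k <= d by exact: leq_trans (le_nb k) (le_d' k).
have n_gt0 : 0 < n by lia.
have nb'j : nb' j = d by have := le_nb j; have := le_d' j; lia.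
have [s def_s] := definable_class_of tau_gt0 n_gt0 adm'.
have [[phi [phi_d phiP <-]] _] := complexityP def_s.
have := gsize_ge n_gt le_d' phi_d phiP.
set S := constrained d nb' => le_phi; apply: leq_trans le_phi.
have notS i : i \notin S -> i = j.
  by rewrite inE => /existsPn/(_ j); rewrite nb'j eqxx andbT negbK => /eqP.
(* As tau is nonempty there is a type other than j, and it is constrained. *)
have S_n0 : S != set0.
  have : 0 < #|predC1 j|.
    by rewrite cardC1 card_mtype -subn1 subn_gt0 -{1}(expn0 2) ltn_exp2l.
  case/card_gt0P=> i; rewrite inE => nij.
  by apply/set0Pn; exists i; apply: contraR nij => /notS->.
apply: (@leq_ltn_trans (\sum_(i in S) nb i + c_tau tau)).
  apply: complexity_le => // A S_A; apply/(class_ofP _ le_d) => i.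
  case: (boolP (i \in S)) => [/S_A // | iS]; have ij := notS i iS.
  (* All types other than j have entries below d, hence exact counts; this
     leaves at least d points for j. *)
  have lt_k k : k != j -> cell A k <= d.
    move=> nkj; have Sk : k \in S by apply: contraR nkj => /notS->.
    have := S_A k Sk; have : nb k < d; last by lia.
    move: iS; rewrite inE => /existsPn/(_ k); rewrite ij nkj /= => neq.
    by rewrite (leq_ltn_trans (le_nb k)) // ltn_neqAle neq le_d'.
  rewrite ij nbj; apply/minn_idPr.
  set rest := \sum_(k : mtype tau | k != j) cell A k.
  have cell_rest : cell A j + rest = n.
    rewrite -[RHS](tcount_setT A) tcount_sum [RHS](bigD1 j) ?inE //=.
    by congr (_ + _); apply: eq_bigl => k; rewrite inE.
  have rest_le : rest <= ntypes tau * d.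
    rewrite -sum_nat_const [leqRHS](bigID (fun k => k != j)) /=.
    by apply: leq_trans (leq_addr _ _); apply: leq_sum.
  have t_gt0 : 0 < ntypes tau by apply/card_gt0P; exists j.
  by have := leq_pmull d t_gt0; rewrite mulnS in n_gt; lia.
have -> : \sum_(i in S) nb' i = \sum_(i in S) nb i + \sum_i (nb' i - nb i).
  rewrite [X in _ + X](bigID (mem S)) /= [X in _ + (_ + X)]big1 => [|i /notS->].
    by rewrite addn0 -big_split; apply: eq_bigr => i _ /=; rewrite subnKC.
  by rewrite nbj nb'j subnn.
by rewrite ltn_add2l.
Qed.

Lemma prec_tau_lt (tau : finType) (n d : nat) (nb nb' : ntuple tau) :
  0 < #|tau| -> 2 * (ntypes tau * d.+1) < n ->
  admissible n d nb -> admissible n d nb' -> prec_tau nb nb' -> nb != nb' ->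
  #|class_of n d nb| < #|class_of n d nb'| /\
  complexity d (class_of n d nb) < complexity d (class_of n d nb').
Proof.
move=> tau_gt0 n_gt adm adm' /andP[/forallP le_nb + neq]; rewrite (negPf neq) /= => gt_c.
have n_gt' : 2 * (ntypes tau * d) < n by apply: leq_ltn_trans n_gt; rewrite !leq_mul.
have /andP[/forallP le_d' _] := adm'.
have /and3P[/forallP le_d _ full] := adm.
have [j nbj] : exists j, nb j = d.
  case/orP: full => [/existsP[j /eqP] | /eqP sum_n]; first by exists j.
  have : \sum_i nb i <= ntypes tau * d.
    by rewrite -sum_nat_const leq_sum // => i _; apply: le_d.
  by rewrite sum_n; lia.
split; last exact: (complexity_lt tau_gt0 n_gt le_d' le_nb nbj adm' gt_c).
have := card_class_mono n_gt' le_d' le_nb (class_of_gt0 n_gt' le_d nbj).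
by rewrite neq addn1.
Qed.

Theorem theorem4p8 (tau : finType) (tau_gt0 : 0 < #|tau|)
    (d : nat) (d_gt0 : 0 < d) :
  exists n0 : nat, forall n : nat, n0 <= n ->
    (forall nb nb' : ntuple tau,
       admissible n d nb -> admissible n d nb' ->
       prec_tau nb nb' -> le_s n d nb nb' /\ le_c n d nb nb')
    /\
    (forall nb nb' : ntuple tau,
       admissible n d nb -> admissible n d nb' ->
       nb <> nb' -> prec_tau nb nb' \/ prec_tau nb' nb ->
       (#|class_of n d nb| < #|class_of n d nb'| <->
        complexity d (class_of n d nb) < complexity d (class_of n d nb'))).
Proof.
exists (2 * (ntypes tau * d.+1)).+1 => n n_gt.
have lt_both nb nb' := @prec_tau_lt tau n d nb nb' tau_gt0 n_gt.
split=> nb nb' adm adm' => [prec | /eqP neq [prec | prec]].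
- rewrite /le_s /le_c; case: eqVneq => //= neq.
  by have [-> ->] := lt_both _ _ adm adm' prec neq.
- by have [-> ->] := lt_both _ _ adm adm' prec neq.
- have [lt_s lt_c] := lt_both _ _ adm' adm prec (contra_neq (@esym _ _ _) neq).
  by rewrite !ltnNge !(ltnW lt_s) !(ltnW lt_c).
Qed.
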